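(* For $z=0$, there exists a pair of singular links that are distinguished by $\Upsilon_{x,y,z}$ but are not distinguished by $\Psi_{x,y}$. That is, there exist singular links $SL_1,SL_2$ with $\Upsilon_{x,y,0}(SL_1)\ne\Upsilon_{x,y,0}(SL_2)$ and $\Psi_{x,y}(SL_1)=\Psi_{x,y}(SL_2)$.
   Context: Singular links and singular braids. A singular link is the image of a smooth immersion of finitely many oriented circles into $S^3$ with finitely many transversal double points (singular crossings); two are isotopic if some orientation preserving self-homeomorphism of $S^3$ maps one to the other, keeping a small rigid disc around each singular crossing unaltered. $SB_n$ is the monoid generated by $\sigma_1^{\pm1},\dots,\sigma_{n-1}^{\pm1}$ (mutually inverse) and $\tau_1,\dots,\tau_{n-1}$, subject to: $\sigma_i\sigma_j=\sigma_j\sigma_i$ if $|i-j|\ge2$; $\sigma_i\sigma_j\sigma_i=\sigma_j\sigma_i\sigma_j$ if $|i-j|=1$; $\sigma_i\tau_j=\tau_j\sigma_i$ if $|i-j|\ne1$; $\sigma_i\sigma_j\tau_i=\tau_j\sigma_i\sigma_j$ if $|i-j|=1$; $\tau_i\tau_j=\tau_j\tau_i$ if $|i-j|\ge2$. Here $\sigma_i$ is the braid whose $i$-th strand goes under the $(i+1)$-th, and $\tau_i$ is the singular crossing of strands $i,i+1$. Every singular link is isotopic to the closure $\widehat\alpha$ of some $\alpha\in SB_n$. Two parameter bt-algebra. Let $\mathbb{K}=\mathbb{C}(u,v)$. $\mathcal{E}_n(u,v)$ is the unital $\mathbb{K}$-algebra generated by $R_1,\dots,R_{n-1},E_1,\dots,E_{n-1}$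 subject to: $E_iE_j=E_jE_i$; $E_i^2=E_i$; $E_iR_j=R_jE_i$ if $|i-j|\ne1$; $E_iR_jR_i=R_jR_iE_j$ and $E_iE_jR_i=E_jR_iE_j=R_iE_iE_j$ if $|i-j|=1$; $R_iR_j=R_jR_i$ if $|i-j|\ge2$; $R_iR_jR_i=R_jR_iR_j$ if $|i-j|=1$; $R_i^2=1+(u-1)E_i+(v-1)E_iR_i$. Each $R_i$ is invertible. For commuting variables $\mathsf{a},\mathsf{b}$ there is a unique family of linear maps $\mathsf{tr}_n:\mathcal{E}_n(u,v)\to\mathbb{K}(\mathsf{a},\mathsf{b})$ with $\mathsf{tr}_n(1)=1$, $\mathsf{tr}_n(XY)=\mathsf{tr}_n(YX)$, $\mathsf{tr}_{n+1}(X)=\mathsf{tr}_n(X)$, $\mathsf{tr}_{n+1}(XR_n)=\mathsf{tr}_{n+1}(XE_nR_n)=\mathsf{a}\,\mathsf{tr}_n(X)$, $\mathsf{tr}_{n+1}(XE_n)=\mathsf{b}\,\mathsf{tr}_n(X)$ for $X,Y\in\mathcal{E}_n(u,v)$. The one parameter bt-algebra $\mathcal{E}_n(u)$ is the specialization $v=u$ (generators $T_i,E_i$, with $T_i^2=1+(u-1)E_i+(u-1)E_iT_i$), with the corresponding trace again denoted $\mathsf{tr}_n$. Invariants. $x,y,z$ are commuting variables. $\Upsilon_{x,y,z}(L)=\left(\frac{1}{\mathsf{a}w}\right)^{n-1}\mathsf{tr}_n(\rho(\alpha))$ for $L=\widehat\alpha$, $\alpha\in SB_n$, where $w^2=\frac{\mathsf{a}+(1-v)\mathsf{b}}{\mathsf{a}u}$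 and $\rho:SB_n\to\mathcal{E}_n(u,v)$ (scalars extended) is the homomorphism $\sigma_i\mapsto wR_i$, $\tau_i\mapsto x+ywR_i+zw^{-1}R_i^{-1}$. $\Psi_{x,y}(L)=\left(\frac{1}{\mathsf{a}\sqrt{\mathsf{c}}}\right)^{n-1}\mathsf{tr}_n(\psi(\alpha))$ for $L=\widehat\alpha$, $\alpha\in SB_n$, where $\mathsf{c}=\frac{\mathsf{a}+(1-u)\mathsf{b}}{\mathsf{a}u}$ and $\psi:SB_n\to\mathcal{E}_n(u)$ (scalars extended) is the homomorphism $\sigma_i\mapsto wT_i$, $\tau_i\mapsto x+wyT_i$ with $w=\sqrt{\mathsf{c}}$. Both are isotopy invariants of singular links. A pair of singular links is distinguished by an invariant if the invariant takes different values on them. *)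

(* Defs.v *)
From HB Require Import structures.
From mathcomp Require Import all_boot all_order all_algebra fraction.
From mathcomp Require Import boolp reals complex.
From mathcomp Require Import mpoly ring zify ssrAC.

Set Implicit Arguments.
Unset Strict Implicit.
Unset Printing Implicit Defensive.

Import GRing.Theory.
Local Open Scope ring_scope.
Local Open Scope quotient_scope.

(* Generators of a monoid or algebra on n strands are indexed by 'I_n.-1, i.e.
   from 0: the generator of index k : 'I_n.-1 involves the strands usually
   numbered k+1 and k+2. *)
Definition adjacent (i j : nat) : bool := (i.+1 == j) || (j.+1 == i).
Definition distant (i j : nat) : bool := (i.+1 < j)%N || (j.+1 < i)%N.

Definition add_strand n : 'I_n.-1 -> 'I_n.+1.-1 := widen_ord (leq_pred n).

Inductive sbgen (n : nat) : Type :=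
  | GSigma of 'I_n.-1
  | GSigmaV of 'I_n.-1
  | GTau of 'I_n.-1.

HB.instance Definition _ n := gen_eqMixin (sbgen n).
HB.instance Definition _ n := gen_choiceMixin (sbgen n).

Inductive sb_relation n : seq (sbgen n) -> seq (sbgen n) -> Prop :=
  | sb_sigmaK (i : 'I_n.-1) : sb_relation [:: GSigma i; GSigmaV i] [::]
  | sb_sigmaVK (i : 'I_n.-1) : sb_relation [:: GSigmaV i; GSigma i] [::]
  | sb_sigmaC (i j : 'I_n.-1) : distant i j ->
      sb_relation [:: GSigma i; GSigma j] [:: GSigma j; GSigma i]
  | sb_braid (i j : 'I_n.-1) : adjacent i j ->
      sb_relation [:: GSigma i; GSigma j; GSigma i]
                  [:: GSigma j; GSigma i; GSigma j]
  | sb_sigma_tauC (i j : 'I_n.-1) : ~~ adjacent i j ->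
      sb_relation [:: GSigma i; GTau j] [:: GTau j; GSigma i]
  | sb_sigma_tau_braid (i j : 'I_n.-1) : adjacent i j ->
      sb_relation [:: GSigma i; GSigma j; GTau i]
                  [:: GTau j; GSigma i; GSigma j]
  | sb_tauC (i j : 'I_n.-1) : distant i j ->
      sb_relation [:: GTau i; GTau j] [:: GTau j; GTau i].

Inductive sb_congr n : seq (sbgen n) -> seq (sbgen n) -> Prop :=
  | sb_congr_rel p q s t : sb_relation s t ->
      sb_congr (p ++ s ++ q) (p ++ t ++ q)
  | sb_congr_refl s : sb_congr s s
  | sb_congr_sym s t : sb_congr s t -> sb_congr t s
  | sb_congr_trans t s r : sb_congr s t -> sb_congr t r -> sb_congr s r.

Section SingularBraidMonoid.
Variable n : nat.

Definition sb_eqb (s t : seq (sbgen n)) : bool := `[< sb_congr s t >].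

Lemma sb_eqb_equiv : equiv_class_of sb_eqb.
Proof.
split=> [s|s t|t s r].
- by apply/asboolP; apply: sb_congr_refl.
- by apply/asboolP/asboolP; apply: sb_congr_sym.
- by move=> /asboolP h1 /asboolP h2; apply/asboolP; apply: sb_congr_trans h2.
Qed.

Canonical sb_equiv := EquivRelPack sb_eqb_equiv.

Definition sbraid : Type := {eq_quot sb_equiv}.
HB.instance Definition _ := Choice.on sbraid.
HB.instance Definition _ := EqQuotient.on sbraid.

Lemma sbraid_eqP (s t : seq (sbgen n)) :
  sb_congr s t <-> \pi_sbraid s = \pi_sbraid t.
Proof.
split=> [h|/eqmodP/asboolP//].
by apply/eqmodP/asboolP.
Qed.

Lemma sb_congr_cat (s s' t t' : seq (sbgen n)) :
  sb_congr s s' -> sb_congr t t' -> sb_congr (s ++ t) (s' ++ t').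
Proof.
have catl (p x y : seq (sbgen n)) : sb_congr x y -> sb_congr (p ++ x) (p ++ y).
  elim=> {x y} [q r x y h|x|x y _ h|y x z _ h1 _ h2].
  - by rewrite !catA -!(catA (p ++ q)); apply: sb_congr_rel.
  - exact: sb_congr_refl.
  - exact: sb_congr_sym.
  - exact: sb_congr_trans h2.
have catr (p x y : seq (sbgen n)) : sb_congr x y -> sb_congr (x ++ p) (y ++ p).
  elim=> {x y} [q r x y h|x|x y _ h|y x z _ h1 _ h2].
  - by rewrite -!catA; apply: sb_congr_rel.
  - exact: sb_congr_refl.
  - exact: sb_congr_sym.
  - exact: sb_congr_trans h2.
by move=> hs ht; apply: sb_congr_trans (catr _ _ _ hs) (catl _ _ _ ht).
Qed.

Definition sb_one : sbraid := \pi_sbraid [::].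
Definition sb_mul (x y : sbraid) : sbraid := \pi_sbraid (repr x ++ repr y).

Lemma sb_repr s : sb_congr (repr (\pi_sbraid s)) s.
Proof. by apply/sbraid_eqP; rewrite reprK. Qed.

Lemma sb_mul_pi s t :
  sb_mul (\pi_sbraid s) (\pi_sbraid t) = \pi_sbraid (s ++ t).
Proof. by apply/sbraid_eqP; apply: sb_congr_cat; apply: sb_repr. Qed.

Lemma sb_mulA : associative sb_mul.
Proof.
elim/quotW=> x; elim/quotW=> y; elim/quotW=> z.
by rewrite (sb_mul_pi y z) !(sb_mul_pi x) (sb_mul_pi (x ++ y)) catA.
Qed.
Lemma sb_mul1 : left_id sb_one sb_mul.
Proof. by elim/quotW=> x; apply: sb_mul_pi. Qed.
Lemma sb_mulr1 : right_id sb_one sb_mul.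
Proof. by elim/quotW=> x; rewrite -{2}[x]cats0; apply: sb_mul_pi. Qed.

HB.instance Definition _ := isMonoid.Build sbraid sb_mulA sb_mul1 sb_mulr1.

Definition sigma (i : 'I_n.-1) : sbraid := \pi_sbraid [:: GSigma i].
Definition sigmaV (i : 'I_n.-1) : sbraid := \pi_sbraid [:: GSigmaV i].
Definition tau (i : 'I_n.-1) : sbraid := \pi_sbraid [:: GTau i].

End SingularBraidMonoid.

Definition sbgen_add_strand n (g : sbgen n) : sbgen n.+1 :=
  match g with
  | GSigma i => GSigma (n := n.+1) (add_strand i)
  | GSigmaV i => GSigmaV (n := n.+1) (add_strand i)
  | GTau i => GTau (n := n.+1) (add_strand i)
  end.

Definition sb_add_strand n (alpha : sbraid n) : sbraid n.+1 :=
  \pi_(sbraid n.+1) (map (@sbgen_add_strand n) (repr alpha)).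

Lemma sb_add_strand_congr n (s t : seq (sbgen n)) : sb_congr s t ->
  sb_congr (map (@sbgen_add_strand n) s) (map (@sbgen_add_strand n) t).
Proof.
elim=> {s t} [p q s t h|s|s t _|t s r _ h1 _ h2].
- by rewrite !map_cat; apply: sb_congr_rel; case: h => *; constructor.
- exact: sb_congr_refl.
- exact: sb_congr_sym.
- exact: sb_congr_trans h2.
Qed.

Lemma sb_add_strand_pi n s :
  sb_add_strand (\pi_(sbraid n) s) =
  \pi_(sbraid n.+1) (map (@sbgen_add_strand n) s).
Proof. by apply/sbraid_eqP; apply: sb_add_strand_congr; apply: sb_repr. Qed.

(* A singular link up to isotopy is represented as the closure of a singular
   braid.  Every singular link is isotopic to such a closure (Birman), and two
   closures are isotopic, rigidly around the double points, exactly when the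
   singular braids are related by the moves below (Gemein). *)
Definition any_sbraid : Type := {n : nat & sbraid n.+1}.
HB.instance Definition _ := Choice.on any_sbraid.

Definition sbraid_pack n (alpha : sbraid n.+1) : any_sbraid :=
  existT (fun m => sbraid m.+1) n alpha.

Inductive markov_equiv : any_sbraid -> any_sbraid -> Prop :=
  | markov_conj n (alpha beta : sbraid n.+1) :
      markov_equiv (sbraid_pack (alpha * beta)%g)
                   (sbraid_pack (beta * alpha)%g)
  | markov_stab n (alpha : sbraid n.+1) :
      markov_equiv (sbraid_pack alpha)
        (sbraid_pack (sb_add_strand alpha * sigma (n := n.+2) ord_max)%g)
  | markov_stabV n (alpha : sbraid n.+1) :
      markov_equiv (sbraid_pack alpha)
        (sbraid_pack (sb_add_strand alpha * sigmaV (n := n.+2) ord_max)%g)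
  | markov_refl A : markov_equiv A A
  | markov_sym A B : markov_equiv A B -> markov_equiv B A
  | markov_trans B A C :
      markov_equiv A B -> markov_equiv B C -> markov_equiv A C.

Definition markov_eqb (A B : any_sbraid) : bool := `[< markov_equiv A B >].

Lemma markov_eqb_equiv : equiv_class_of markov_eqb.
Proof.
split=> [A|A B|B A C].
- by apply/asboolP; apply: markov_refl.
- by apply/asboolP/asboolP; apply: markov_sym.
- by move=> /asboolP h1 /asboolP h2; apply/asboolP; apply: markov_trans h2.
Qed.

Canonical markov_rel := EquivRelPack markov_eqb_equiv.

Definition singular_link : Type := {eq_quot markov_rel}.
HB.instance Definition _ := Choice.on singular_link.
HB.instance Definition _ := EqQuotient.on singular_link.

Lemma singular_linkP (A B : any_sbraid) :
  markov_equiv A B <-> \pi_singular_link A = \pi_singular_link B.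
Proof.
split=> [h|/eqmodP/asboolP//].
by apply/eqmodP/asboolP.
Qed.

Definition closure n (alpha : sbraid n.+1) : singular_link :=
  \pi_singular_link (sbraid_pack alpha).

Inductive btterm (F : Type) (n : nat) : Type :=
  | TR of 'I_n.-1
  | TE of 'I_n.-1
  | TZero
  | TOne
  | TAdd of btterm F n & btterm F n
  | TOpp of btterm F n
  | TMul of btterm F n & btterm F n
  | TScale of F & btterm F n.

Arguments TR {F n}.
Arguments TE {F n}.
Arguments TZero {F n}.
Arguments TOne {F n}.

HB.instance Definition _ F n := gen_eqMixin (btterm F n).
HB.instance Definition _ F n := gen_choiceMixin (btterm F n).

Declare Scope btterm_scope.
Delimit Scope btterm_scope with T.
Notation "0" := TZero : btterm_scope.
Notation "1" := TOne : btterm_scope.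
Notation "s + t" := (TAdd s t) : btterm_scope.
Notation "- s" := (TOpp s) : btterm_scope.
Notation "s * t" := (TMul s t) : btterm_scope.
Notation "c *: s" := (TScale c%R s) : btterm_scope.
Bind Scope btterm_scope with btterm.

Section BtRelations.
Local Open Scope btterm_scope.
Variables (F : fieldType) (u v : F) (n : nat).
Implicit Types i j : 'I_n.-1.

Inductive bt_relation : btterm F n -> btterm F n -> Prop :=
  | bt_EE i j : bt_relation (TE i * TE j) (TE j * TE i)
  | bt_Eidem i : bt_relation (TE i * TE i) (TE i)
  | bt_ER i j : ~~ adjacent i j -> bt_relation (TE i * TR j) (TR j * TE i)
  | bt_ERR i j : adjacent i j ->
      bt_relation (TE i * TR j * TR i) (TR j * TR i * TE j)
  | bt_EER_ERE i j : adjacent i j ->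
      bt_relation (TE i * TE j * TR i) (TE j * TR i * TE j)
  | bt_ERE_REE i j : adjacent i j ->
      bt_relation (TE j * TR i * TE j) (TR i * TE i * TE j)
  | bt_RR i j : distant i j -> bt_relation (TR i * TR j) (TR j * TR i)
  | bt_braid i j : adjacent i j ->
      bt_relation (TR i * TR j * TR i) (TR j * TR i * TR j)
  | bt_quadratic i :
      bt_relation (TR i * TR i)
                  (1 + (u - 1) *: TE i + (v - 1) *: (TE i * TR i)).

(* Equality in the unital associative F-algebra presented by [bt_relation]. *)
Inductive bt_congr : btterm F n -> btterm F n -> Prop :=
  | bt_rel s t : bt_relation s t -> bt_congr s t
  | bt_refl s : bt_congr s s
  | bt_sym s t : bt_congr s t -> bt_congr t s
  | bt_trans t s r : bt_congr s t -> bt_congr t r -> bt_congr s r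
  | bt_add s s' t t' :
      bt_congr s s' -> bt_congr t t' -> bt_congr (s + t) (s' + t')
  | bt_opp s s' : bt_congr s s' -> bt_congr (- s) (- s')
  | bt_mul s s' t t' :
      bt_congr s s' -> bt_congr t t' -> bt_congr (s * t) (s' * t')
  | bt_scale c s s' : bt_congr s s' -> bt_congr (c *: s) (c *: s')
  | bt_addA s t r : bt_congr (s + (t + r)) (s + t + r)
  | bt_addC s t : bt_congr (s + t) (t + s)
  | bt_add0 s : bt_congr (0 + s) s
  | bt_addN s : bt_congr (- s + s) 0
  | bt_mulA s t r : bt_congr (s * (t * r)) (s * t * r)
  | bt_mul1 s : bt_congr (1 * s) s
  | bt_mulr1 s : bt_congr (s * 1) s
  | bt_mulDl s t r : bt_congr ((s + t) * r) (s * r + t * r)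
  | bt_mulDr s t r : bt_congr (s * (t + r)) (s * t + s * r)
  | bt_scaleA c d s : bt_congr (c *: (d *: s)) ((c * d) *: s)
  | bt_scale1 s : bt_congr (1 *: s) s
  | bt_scaleDr c s t : bt_congr (c *: (s + t)) (c *: s + c *: t)
  | bt_scaleDl c d s : bt_congr ((c + d) *: s) (c *: s + d *: s)
  | bt_scaleAl c s t : bt_congr (c *: (s * t)) ((c *: s) * t)
  | bt_scaleAr c s t : bt_congr (c *: (s * t)) (s * (c *: t)).

End BtRelations.

Section BtAlgebra.
Variables (F : fieldType) (u v : F) (n : nat).

Definition bt_eqb (s t : btterm F n) : bool := `[< bt_congr u v s t >].

Lemma bt_eqb_equiv : equiv_class_of bt_eqb.
Proof.
split=> [s|s t|t s r].
- by apply/asboolP; apply: bt_refl.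
- by apply/asboolP/asboolP; apply: bt_sym.
- by move=> /asboolP h1 /asboolP h2; apply/asboolP; apply: bt_trans h2.
Qed.

Canonical bt_equiv := EquivRelPack bt_eqb_equiv.

Definition btalg : Type := {eq_quot bt_equiv}.
HB.instance Definition _ := Choice.on btalg.
HB.instance Definition _ := EqQuotient.on btalg.

Lemma btalg_eqP (s t : btterm F n) :
  bt_congr u v s t <-> \pi_btalg s = \pi_btalg t.
Proof.
split=> [h|/eqmodP/asboolP//].
by apply/eqmodP/asboolP.
Qed.

Lemma bt_repr s : bt_congr u v (repr (\pi_btalg s)) s.
Proof. by apply/btalg_eqP; rewrite reprK. Qed.

Definition bta_zero := lift_cst btalg (@TZero F n).
Definition bta_one := lift_cst btalg (@TOne F n).
Definition bta_add := lift_op2 btalg (@TAdd F n).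
Definition bta_opp := lift_op1 btalg (@TOpp F n).
Definition bta_mul := lift_op2 btalg (@TMul F n).
Definition bta_scale (c : F) := lift_op1 btalg (@TScale F n c).

Canonical bta_zero_pi := PiConst bta_zero.
Canonical bta_one_pi := PiConst bta_one.

Lemma bt_pi_add : {morph \pi_btalg : s t / TAdd s t >-> bta_add s t}.
Proof.
unlock bta_add => s t; apply/btalg_eqP; apply: bt_add;
  by apply: bt_sym; apply: bt_repr.
Qed.
Canonical bta_add_pi := PiMorph2 bt_pi_add.

Lemma bt_pi_opp : {morph \pi_btalg : s / TOpp s >-> bta_opp s}.
Proof.
unlock bta_opp => s; apply/btalg_eqP; apply: bt_opp.
by apply: bt_sym; apply: bt_repr.
Qed.
Canonical bta_opp_pi := PiMorph1 bt_pi_opp.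

Lemma bt_pi_mul : {morph \pi_btalg : s t / TMul s t >-> bta_mul s t}.
Proof.
unlock bta_mul => s t; apply/btalg_eqP; apply: bt_mul;
  by apply: bt_sym; apply: bt_repr.
Qed.
Canonical bta_mul_pi := PiMorph2 bt_pi_mul.

Lemma bt_pi_scale c : {morph \pi_btalg : s / TScale c s >-> bta_scale c s}.
Proof.
unlock bta_scale => s; apply/btalg_eqP; apply: bt_scale.
by apply: bt_sym; apply: bt_repr.
Qed.
Canonical bta_scale_pi c := PiMorph1 (bt_pi_scale c).

Fact bta_addA : associative bta_add.
Proof.
elim/quotW=> x; elim/quotW=> y; elim/quotW=> z; rewrite !piE.
by apply/btalg_eqP; apply: bt_addA.
Qed.
Fact bta_addC : commutative bta_add.
Proof.
elim/quotW=> x; elim/quotW=> y; rewrite !piE.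
by apply/btalg_eqP; apply: bt_addC.
Qed.
Fact bta_add0 : left_id bta_zero bta_add.
Proof. by elim/quotW=> x; rewrite !piE; apply/btalg_eqP; apply: bt_add0. Qed.
Fact bta_addN : left_inverse bta_zero bta_opp bta_add.
Proof. by elim/quotW=> x; rewrite !piE; apply/btalg_eqP; apply: bt_addN. Qed.
HB.instance Definition _ :=
  GRing.isZmodule.Build btalg bta_addA bta_addC bta_add0 bta_addN.

Fact bta_mulA : associative bta_mul.
Proof.
elim/quotW=> x; elim/quotW=> y; elim/quotW=> z; rewrite !piE.
by apply/btalg_eqP; apply: bt_mulA.
Qed.
Fact bta_mul1 : left_id bta_one bta_mul.
Proof. by elim/quotW=> x; rewrite !piE; apply/btalg_eqP; apply: bt_mul1. Qed.
Fact bta_mulr1 : right_id bta_one bta_mul.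
Proof. by elim/quotW=> x; rewrite !piE; apply/btalg_eqP; apply: bt_mulr1. Qed.
Fact bta_mulDl : left_distributive bta_mul bta_add.
Proof.
elim/quotW=> x; elim/quotW=> y; elim/quotW=> z; rewrite !piE.
by apply/btalg_eqP; apply: bt_mulDl.
Qed.
Fact bta_mulDr : right_distributive bta_mul bta_add.
Proof.
elim/quotW=> x; elim/quotW=> y; elim/quotW=> z; rewrite !piE.
by apply/btalg_eqP; apply: bt_mulDr.
Qed.

(* The character R_i |-> 1, E_i |-> 0 shows that the algebra is nonzero. *)
Fixpoint bt_augmentation (s : btterm F n) : F :=
  match s with
  | TR _ => 1
  | TE _ => 0
  | TZero => 0
  | TOne => 1
  | TAdd s t => bt_augmentation s + bt_augmentation t
  | TOpp s => - bt_augmentation s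
  | TMul s t => bt_augmentation s * bt_augmentation t
  | TScale c s => c * bt_augmentation s
  end.

Lemma bt_augmentation_congr s t :
  bt_congr u v s t -> bt_augmentation s = bt_augmentation t.
Proof.
elim=> //= {s t}; try by move=> *; congr (_ + _).
- by move=> s t [] *; rewrite /= ?(mul0r, mulr0, mulr1, mul1r, addr0).
- by move=> t s r _ -> _ ->.
- by move=> s s' _ ->.
- by move=> s s' t t' _ -> _ ->.
- by move=> c s s' _ ->.
- by move=> *; rewrite addrA.
- by move=> *; rewrite addrC.
- by move=> *; rewrite add0r.
- by move=> *; rewrite addNr.
- by move=> *; rewrite mulrA.
- by move=> *; rewrite mul1r.
- by move=> *; rewrite mulr1.
- by move=> *; rewrite mulrDl.
- by move=> *; rewrite mulrDr.
- by move=> *; rewrite mulrA.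
- by move=> *; rewrite mul1r.
- by move=> *; rewrite mulrDr.
- by move=> *; rewrite mulrDl.
- by move=> *; rewrite mulrA.
- by move=> *; rewrite mulrCA.
Qed.

Fact bta_one_neq0 : bta_one != bta_zero.
Proof.
apply/eqP; unlock bta_one bta_zero => /btalg_eqP h.
have := bt_augmentation_congr h => /=.
by move/eqP; rewrite oner_eq0.
Qed.

HB.instance Definition _ := GRing.Zmodule_isNzRing.Build btalg
  bta_mulA bta_mul1 bta_mulr1 bta_mulDl bta_mulDr bta_one_neq0.

Fact bta_scaleA c d X : bta_scale c (bta_scale d X) = bta_scale (c * d) X.
Proof.
by elim/quotW: X => x; rewrite !piE; apply/btalg_eqP; apply: bt_scaleA.
Qed.
Fact bta_scale1 : left_id 1 bta_scale.
Proof. by elim/quotW=> x; rewrite !piE; apply/btalg_eqP; apply: bt_scale1. Qed.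
Fact bta_scaleDr : right_distributive bta_scale bta_add.
Proof.
move=> c; elim/quotW=> x; elim/quotW=> y; rewrite !piE.
by apply/btalg_eqP; apply: bt_scaleDr.
Qed.
Fact bta_scaleDl X c d : bta_scale (c + d) X = bta_add (bta_scale c X) (bta_scale d X).
Proof.
by elim/quotW: X => x; rewrite !piE; apply/btalg_eqP; apply: bt_scaleDl.
Qed.
HB.instance Definition _ := GRing.Zmodule_isLmodule.Build F btalg
  bta_scaleA bta_scale1 bta_scaleDr bta_scaleDl.

Fact bta_scaleAl c X Y : bta_scale c (bta_mul X Y) = bta_mul (bta_scale c X) Y.
Proof.
elim/quotW: X => x; elim/quotW: Y => y; rewrite !piE.
by apply/btalg_eqP; apply: bt_scaleAl.
Qed.
HB.instance Definition _ := GRing.Lmodule_isLalgebra.Build F btalg bta_scaleAl.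

Fact bta_scaleAr c X Y : bta_scale c (bta_mul X Y) = bta_mul X (bta_scale c Y).
Proof.
elim/quotW: X => x; elim/quotW: Y => y; rewrite !piE.
by apply/btalg_eqP; apply: bt_scaleAr.
Qed.
HB.instance Definition _ := GRing.Lalgebra_isAlgebra.Build F btalg bta_scaleAr.

Definition bta_unit (X : btalg) : bool := `[< exists Y, Y * X = 1 /\ X * Y = 1 >].

Definition bta_inv (X : btalg) : btalg :=
  if pselect (exists Y, Y * X = 1 /\ X * Y = 1) is left h then projT1 (cid h)
  else X.

Fact bta_mulVr : {in bta_unit, left_inverse 1 bta_inv *%R}.
Proof.
move=> X /asboolP h; rewrite /bta_inv; case: pselect => // k.
by case: (projT2 (cid k)).
Qed.
Fact bta_divrr : {in bta_unit, right_inverse 1 bta_inv *%R}.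
Proof.
move=> X /asboolP h; rewrite /bta_inv; case: pselect => // k.
by case: (projT2 (cid k)).
Qed.
Fact bta_unitrP X Y : Y * X = 1 /\ X * Y = 1 -> bta_unit X.
Proof. by move=> h; apply/asboolP; exists Y. Qed.
Fact bta_invr_out : {in [predC bta_unit], bta_inv =1 id}.
Proof.
move=> X /negP h; rewrite /bta_inv; case: pselect => // k.
by case: h; apply/asboolP.
Qed.
HB.instance Definition _ := GRing.NzRing_hasMulInverse.Build btalg
  bta_mulVr bta_divrr bta_unitrP bta_invr_out.

Definition btR (i : 'I_n.-1) : btalg := \pi_btalg (TR i).
Definition btE (i : 'I_n.-1) : btalg := \pi_btalg (TE i).

Lemma bt_pi_zero : \pi_btalg TZero = 0. Proof. by rewrite piE. Qed.
Lemma bt_pi_one : \pi_btalg TOne = 1. Proof. by rewrite piE. Qed.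
Lemma bt_piD s t : \pi_btalg (TAdd s t) = \pi_btalg s + \pi_btalg t.
Proof. exact: bt_pi_add. Qed.
Lemma bt_piN s : \pi_btalg (TOpp s) = - \pi_btalg s.
Proof. exact: bt_pi_opp. Qed.
Lemma bt_piM s t : \pi_btalg (TMul s t) = \pi_btalg s * \pi_btalg t.
Proof. exact: bt_pi_mul. Qed.
Lemma bt_piZ c s : \pi_btalg (TScale c s) = c *: \pi_btalg s.
Proof. exact: bt_pi_scale. Qed.

Definition bt_piE :=
  (bt_piD, bt_piN, bt_piM, bt_piZ, bt_pi_zero, bt_pi_one).

Lemma bt_relationP s t : bt_relation u v s t -> \pi_btalg s = \pi_btalg t.
Proof. by move=> h; apply/btalg_eqP; apply: bt_rel. Qed.

Lemma btE_C i j : btE i * btE j = btE j * btE i.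
Proof. by have := bt_relationP (bt_EE u v i j); rewrite !bt_piE. Qed.
Lemma btE_idem i : btE i * btE i = btE i.
Proof. by have := bt_relationP (bt_Eidem u v i); rewrite !bt_piE. Qed.
Lemma btER_C (i j : 'I_n.-1) : ~~ adjacent i j -> btE i * btR j = btR j * btE i.
Proof. by move=> h; have := bt_relationP (bt_ER u v h); rewrite !bt_piE. Qed.
Lemma btR_C (i j : 'I_n.-1) : distant i j -> btR i * btR j = btR j * btR i.
Proof. by move=> h; have := bt_relationP (bt_RR u v h); rewrite !bt_piE. Qed.
Lemma btR_braid (i j : 'I_n.-1) : adjacent i j ->
  btR i * btR j * btR i = btR j * btR i * btR j.
Proof. by move=> h; have := bt_relationP (bt_braid u v h); rewrite !bt_piE. Qed.
Lemma btR_sqr i :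
  btR i * btR i = 1 + (u - 1) *: btE i + (v - 1) *: (btE i * btR i).
Proof. by have := bt_relationP (bt_quadratic u v i); rewrite !bt_piE. Qed.

Definition btRV (i : 'I_n.-1) : btalg :=
  btR i + ((1 - v) / u) *: btE i + ((1 - u) / u) *: (btE i * btR i).

Lemma adjacentxx (i : nat) : adjacent i i = false.
Proof. by rewrite /adjacent (gtn_eqF (ltnSn i)). Qed.

Lemma btER i : btE i * btR i = btR i * btE i.
Proof. by apply: btER_C; rewrite adjacentxx. Qed.

Lemma btRVl i : u != 0 -> btRV i * btR i = 1.
Proof.
move=> u0; rewrite /btRV !mulrDl -!scalerAl -mulrA btR_sqr.
rewrite !mulrDr mulr1 -!scalerAr [btE i * (btE i * _)]mulrA btE_idem.
set e := btE i; set er := e * btR i.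
rewrite !scalerDr !scalerA.
have collect p q r p1 p2 q1 :
    1 + p *: e + q *: er + r *: er + (p1 *: e + p2 *: e + q1 *: er) =
    1 + (p + p1 + p2) *: e + (q + r + q1) *: er.
  by rewrite !scalerDl !addrA [LHS](ACl (1*2*5*6*3*4*7)).
rewrite collect [X in X *: e](_ : _ = 0); last by field.
rewrite [X in X *: er](_ : _ = 0); last by field.
by rewrite !scale0r !addr0.
Qed.

Lemma btRVr i : u != 0 -> btR i * btRV i = 1.
Proof.
move=> u0; rewrite -(btRVl i u0) /btRV !mulrDl !mulrDr -!scalerAl -!scalerAr.
by rewrite !mulrA -!btER -[btE i * btR i * btR i]mulrA.
Qed.

Lemma btR_unit i : u != 0 -> btR i \is a GRing.unit.
Proof. by move=> u0; apply/unitrP; exists (btRV i); rewrite btRVl ?btRVr. Qed.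

Lemma btR_inv i : u != 0 -> (btR i)^-1 = btRV i.
Proof.
move=> u0; apply: (mulrI (btR_unit i u0)).
by rewrite divrr ?btR_unit // btRVr.
Qed.

End BtAlgebra.

Fixpoint btterm_add_strand (F : Type) n (s : btterm F n) : btterm F n.+1 :=
  match s with
  | TR i => TR (n := n.+1) (add_strand i)
  | TE i => TE (n := n.+1) (add_strand i)
  | TZero => TZero
  | TOne => TOne
  | TAdd s t => TAdd (btterm_add_strand s) (btterm_add_strand t)
  | TOpp s => TOpp (btterm_add_strand s)
  | TMul s t => TMul (btterm_add_strand s) (btterm_add_strand t)
  | TScale c s => TScale c (btterm_add_strand s)
  end.

(* The homomorphism E_n(u,v) -> E_{n+1}(u,v) fixing the generators, through
   which elements of E_n are regarded as elements of E_{n+1}. *)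
Definition bt_add_strand (F : fieldType) (u v : F) n (X : btalg u v n) :
  btalg u v n.+1 := \pi_(btalg u v n.+1) (btterm_add_strand (repr X)).

Section BtAddStrand.
Variables (F : fieldType) (u v : F) (n : nat).

Lemma bt_add_strand_congr (s t : btterm F n) : bt_congr u v s t ->
  bt_congr u v (btterm_add_strand s) (btterm_add_strand t).
Proof.
elim=> {s t} /=; try by intros; constructor.
- by move=> s t h; apply: bt_rel; case: h => * /=; constructor.
- by move=> s t r _ h1 _ h2; apply: bt_trans h2.
Qed.

Lemma bt_add_strand_pi s :
  bt_add_strand (\pi_(btalg u v n) s) =
  \pi_(btalg u v n.+1) (btterm_add_strand s).
Proof. by apply/btalg_eqP; apply: bt_add_strand_congr; apply: bt_repr. Qed.

Lemma bt_add_strandD (X Y : btalg u v n) :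
  bt_add_strand (X + Y) = bt_add_strand X + bt_add_strand Y.
Proof.
elim/quotW: X => s; elim/quotW: Y => t.
by rewrite -bt_piD !bt_add_strand_pi /= bt_piD.
Qed.

Lemma bt_add_strandM (X Y : btalg u v n) :
  bt_add_strand (X * Y) = bt_add_strand X * bt_add_strand Y.
Proof.
elim/quotW: X => s; elim/quotW: Y => t.
by rewrite -bt_piM !bt_add_strand_pi /= bt_piM.
Qed.

Lemma bt_add_strandZ c (X : btalg u v n) :
  bt_add_strand (c *: X) = c *: bt_add_strand X.
Proof.
elim/quotW: X => s.
by rewrite -bt_piZ !bt_add_strand_pi /= bt_piZ.
Qed.

Lemma bt_add_strand1 : bt_add_strand (1 : btalg u v n) = 1.
Proof. by rewrite -bt_pi_one bt_add_strand_pi /= bt_pi_one. Qed.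

Lemma bt_add_strandR (i : 'I_n.-1) : bt_add_strand (btR u v i) = btR u v (add_strand i).
Proof. exact: bt_add_strand_pi. Qed.

Lemma bt_add_strandE (i : 'I_n.-1) : bt_add_strand (btE u v i) = btE u v (add_strand i).
Proof. exact: bt_add_strand_pi. Qed.

Lemma bt_add_strandV (X : btalg u v n) : X \is a GRing.unit ->
  bt_add_strand X^-1 = (bt_add_strand X)^-1.
Proof.
move=> uX; have h1 : bt_add_strand X * bt_add_strand X^-1 = 1.
  by rewrite -bt_add_strandM divrr // bt_add_strand1.
have h2 : bt_add_strand X^-1 * bt_add_strand X = 1.
  by rewrite -bt_add_strandM mulVr // bt_add_strand1.
have uY : bt_add_strand X \is a GRing.unit.
  by apply/unitrP; exists (bt_add_strand X^-1).
by apply: (mulrI uY); rewrite h1 divrr.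
Qed.

End BtAddStrand.

(* F contains the values of the trace as well: over a field F containing
   C(u,v,a,b), the algebra [btalg u v n] is the bt-algebra over C(u,v) with
   scalars extended to F, and a trace is the F-linear extension of tr_n. *)
Record is_bt_trace (F : fieldType) (u v a b : F)
    (tr : forall n, {scalar btalg u v n}) : Prop := {
  bt_trace1 : forall n, tr n 1 = 1;
  bt_traceC : forall n (X Y : btalg u v n), tr n (X * Y) = tr n (Y * X);
  bt_trace_add_strand : forall n (X : btalg u v n),
    tr n.+1 (bt_add_strand X) = tr n X;
  bt_traceR : forall n (X : btalg u v n.+1),
    tr n.+2 (bt_add_strand X * btR u v (n := n.+2) ord_max) = a * tr n.+1 X;
  bt_traceER : forall n (X : btalg u v n.+1),
    tr n.+2 (bt_add_strand X
             * btE u v (n := n.+2) ord_max * btR u v (n := n.+2) ord_max)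
    = a * tr n.+1 X;
  bt_traceE : forall n (X : btalg u v n.+1),
    tr n.+2 (bt_add_strand X * btE u v (n := n.+2) ord_max) = b * tr n.+1 X
}.

Section Representation.
Variables (A : unitRingType) (n : nat) (s t : 'I_n.-1 -> A).

Definition sbgen_image (g : sbgen n) : A :=
  match g with
  | GSigma i => s i
  | GSigmaV i => (s i)^-1
  | GTau i => t i
  end.

(* The homomorphism sigma_i |-> s i, tau_i |-> t i, computed on a word chosen
   for each element; see [sbrep_pi] and [sbrepM] for its well-definedness. *)
Definition sbrep (alpha : sbraid n) : A :=
  \prod_(g <- repr alpha) sbgen_image g.

Hypothesis s_unit : forall i, s i \is a GRing.unit.
Hypothesis s_comm : forall i j : 'I_n.-1, distant i j -> s i * s j = s j * s i.
Hypothesis s_braid : forall i j : 'I_n.-1, adjacent i j ->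
  s i * s j * s i = s j * s i * s j.
Hypothesis st_comm : forall i j : 'I_n.-1, ~~ adjacent i j ->
  s i * t j = t j * s i.
Hypothesis st_braid : forall i j : 'I_n.-1, adjacent i j ->
  s i * s j * t i = t j * s i * s j.
Hypothesis t_comm : forall i j : 'I_n.-1, distant i j -> t i * t j = t j * t i.

Lemma sbgen_image_congr p q : sb_congr p q ->
  \prod_(g <- p) sbgen_image g = \prod_(g <- q) sbgen_image g.
Proof.
elim=> {p q} [p q x y h|//|x y _ ->//|y x z _ -> _ ->//].
rewrite !big_cat /=; congr (_ * (_ * _)).
case: h => [i|i|i j h|i j h|i j h|i j h|i j h];
  rewrite !(big_cons, big_nil) /= !mulr1 ?mulrA.
- exact: divrr.
- exact: mulVr.
- exact: s_comm.
- exact: s_braid.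
- exact: st_comm.
- exact: st_braid.
- exact: t_comm.
Qed.

Lemma sbrep_pi p : sbrep (\pi_(sbraid n) p) = \prod_(g <- p) sbgen_image g.
Proof. by apply: sbgen_image_congr; apply: sb_repr. Qed.

Lemma sbrepM alpha beta : sbrep (alpha * beta)%g = sbrep alpha * sbrep beta.
Proof.
elim/quotW: alpha => p; elim/quotW: beta => q.
by rewrite [(_ * _)%g]sb_mul_pi !sbrep_pi big_cat.
Qed.

End Representation.

Section Invariants.
Variables (F : fieldType) (u v : F).

Definition rho (w x y z : F) n : sbraid n -> btalg u v n :=
  sbrep (fun i => w *: btR u v i)
        (fun i => x%:A + (y * w) *: btR u v i + (z * w^-1) *: (btR u v i)^-1).

(* [w] is the square root of c; the one parameter algebra is [btalg u u]. *)
Definition psi (w x y : F) n : sbraid n -> btalg u u n :=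
  sbrep (fun i => w *: btR u u i) (fun i => x%:A + (w * y) *: btR u u i).

(* The value on a link is computed from one singular braid with that closure;
   see [Upsilon_closure] and [Psi_closure] for the independence of the choice.
   The singular braid packed with index n has n+1 strands. *)
Definition Upsilon (a w x y z : F) (tr : forall n, {scalar btalg u v n})
    (SL : singular_link) : F :=
  let: existT n alpha := repr SL in
  (1 / (a * w)) ^+ n * tr n.+1 (rho w x y z alpha).

Definition Psi (a w x y : F) (tr : forall n, {scalar btalg u u n})
    (SL : singular_link) : F :=
  let: existT n alpha := repr SL in
  (1 / (a * w)) ^+ n * tr n.+1 (psi w x y alpha).

Section RhoIsMorphism.
Variables (w x y z : F) (n : nat).
Hypotheses (u0 : u != 0) (w0 : w != 0).

Let S (i : 'I_n.-1) : btalg u v n := w *: btR u v i.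
Let T (i : 'I_n.-1) : btalg u v n :=
  x%:A + (y * w) *: btR u v i + (z * w^-1) *: (btR u v i)^-1.

Let S_unit i : S i \is a GRing.unit.
Proof. by rewrite /S scaler_unit ?unitfE // btR_unit. Qed.

Let intertwine (p : btalg u v n) (i j : 'I_n.-1) :
  p * btR u v i = btR u v j * p -> p * T i = T j * p.
Proof.
move=> h; rewrite /T !mulrDr !mulrDl -!scalerAr -!scalerAl mulr1 mul1r h.
congr (_ + _ + _ *: _).
apply: (mulrI (btR_unit v j u0)); rewrite !mulrA -h divrr ?btR_unit // mul1r.
by rewrite -mulrA divrr ?btR_unit // mulr1.
Qed.

Let distant_nadj (i j : nat) : distant i j -> ~~ adjacent i j.
Proof. by rewrite /distant /adjacent; lia. Qed.

Let nadj_cases (i j : 'I_n.-1) : ~~ adjacent i j -> i = j \/ distant i j.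
Proof.
move=> h; have : (i == j :> nat) || distant i j.
  by move: h; rewrite /distant /adjacent; lia.
by case/orP=> [/eqP/val_inj|]; [left|right].
Qed.

Let R_nadj (i j : 'I_n.-1) : ~~ adjacent i j ->
  btR u v i * btR u v j = btR u v j * btR u v i.
Proof. by case/nadj_cases => [-> //|/btR_C]. Qed.

Let S_comm (i j : 'I_n.-1) : distant i j -> S i * S j = S j * S i.
Proof.
by move=> h; rewrite /S -!scalerAl -!scalerAr btR_C.
Qed.

Let S_braid (i j : 'I_n.-1) : adjacent i j -> S i * S j * S i = S j * S i * S j.
Proof.
move=> h; rewrite /S -!(scalerAl, scalerAr) btR_braid //.
Qed.

Let ST_comm (i j : 'I_n.-1) : ~~ adjacent i j -> S i * T j = T j * S i.
Proof.
move=> h; apply: intertwine.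
by rewrite /S -scalerAl -scalerAr R_nadj.
Qed.

Let ST_braid (i j : 'I_n.-1) : adjacent i j -> S i * S j * T i = T j * S i * S j.
Proof.
move=> h; rewrite -[RHS]mulrA; apply: intertwine.
by rewrite /S -!(scalerAl, scalerAr) btR_braid // mulrA.
Qed.

Let T_comm (i j : 'I_n.-1) : distant i j -> T i * T j = T j * T i.
Proof.
move=> h; apply: intertwine; apply: esym; apply: intertwine.
exact/esym/btR_C.
Qed.

Lemma rho_pi p : rho w x y z (\pi_(sbraid n) p) =
  \prod_(g <- p) sbgen_image S T g.
Proof. exact: sbrep_pi. Qed.

Lemma rhoM (alpha beta : sbraid n) :
  rho w x y z (alpha * beta)%g = rho w x y z alpha * rho w x y z beta.
Proof. exact: sbrepM. Qed.

Lemma rho1 : rho w x y z (1%g : sbraid n) = 1.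
Proof. by have := rho_pi [::]; rewrite big_nil. Qed.

Lemma rho_sigma (i : 'I_n.-1) : rho w x y z (sigma i) = w *: btR u v i.
Proof. by rewrite rho_pi big_seq1. Qed.

Lemma rho_sigmaV (i : 'I_n.-1) : rho w x y z (sigmaV i) = w^-1 *: (btR u v i)^-1.
Proof.
by rewrite rho_pi big_seq1 /= /S invrZ ?unitfE // btR_unit.
Qed.

Lemma rho_tau (i : 'I_n.-1) : rho w x y z (tau i) =
  x%:A + (y * w) *: btR u v i + (z * w^-1) *: (btR u v i)^-1.
Proof. by rewrite rho_pi big_seq1. Qed.

End RhoIsMorphism.

Lemma rho_add_strand w x y z n (alpha : sbraid n) : u != 0 -> w != 0 ->
  rho w x y z (sb_add_strand alpha) = bt_add_strand (rho w x y z alpha).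
Proof.
move=> u0 w0; elim/quotW: alpha => p.
rewrite sb_add_strand_pi !rho_pi // big_map.
elim: p => [|g p IH]; first by rewrite !big_nil bt_add_strand1.
rewrite !big_cons bt_add_strandM IH; congr (_ * _).
case: g => i /=.
- by rewrite bt_add_strandZ bt_add_strandR.
- rewrite bt_add_strandV ?bt_add_strandZ ?bt_add_strandR //.
  by rewrite scaler_unit ?unitfE // btR_unit.
- rewrite !bt_add_strandD !bt_add_strandZ bt_add_strandV ?btR_unit //.
  by rewrite !bt_add_strandR bt_add_strand1.
Qed.

Section UpsilonInvariance.
Variables (a b w x y z : F) (tr : forall n, {scalar btalg u v n}).
Hypotheses (u0 : u != 0) (a0 : a != 0) (w0 : w != 0).
Hypothesis w_sqr : w ^+ 2 = (a + (1 - v) * b) / (a * u).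
Hypothesis trP : is_bt_trace a b tr.

Let value (A : any_sbraid) : F :=
  let: existT n alpha := A in
  (1 / (a * w)) ^+ n * tr n.+1 (rho w x y z alpha).

Lemma bt_traceRV n (X : btalg u v n.+1) :
  tr n.+2 (bt_add_strand X * (btR u v (n := n.+2) ord_max)^-1) =
  a * w ^+ 2 * tr n.+1 X.
Proof.
rewrite btR_inv // /btRV !mulrDr -!scalerAr mulrA !linearD !linearZ /=.
rewrite (bt_traceR trP) (bt_traceE trP) (bt_traceER trP) w_sqr.
by field; rewrite u0 a0.
Qed.

Let value_markov A B : markov_equiv A B -> value A = value B.
Proof.
elim=> {A B} [n al be|n al|n al|//|A B _ ->//|B A C _ -> _ ->//] /=.
- by rewrite !rhoM // (bt_traceC trP).
- rewrite rhoM // rho_sigma // rho_add_strand // -scalerAr linearZ /=.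
  rewrite (bt_traceR trP) exprS; field; exact/andP.
- rewrite rhoM // rho_sigmaV // rho_add_strand // -scalerAr linearZ /=.
  rewrite bt_traceRV exprS; field; exact/andP.
Qed.

Lemma Upsilon_closure n (alpha : sbraid n.+1) :
  Upsilon a w x y z tr (closure alpha) =
  (1 / (a * w)) ^+ n * tr n.+1 (rho w x y z alpha).
Proof.
apply: (value_markov (A := repr _) (B := sbraid_pack alpha)).
by apply/singular_linkP; rewrite reprK.
Qed.

End UpsilonInvariance.

End Invariants.

Section PsiInvariance.
Variables (F : fieldType) (u a b w x y : F).
Variable tr : forall n, {scalar btalg u u n}.

Lemma psi_rho n (alpha : sbraid n) : psi u w x y alpha = rho u u w x y 0 alpha.
Proof.
apply: eq_bigr => -[] i //= _.
by rewrite mul0r scale0r addr0 mulrC.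
Qed.

Lemma Psi_closure n (alpha : sbraid n.+1) :
  u != 0 -> a != 0 -> w != 0 ->
  w ^+ 2 = (a + (1 - u) * b) / (a * u) -> is_bt_trace a b tr ->
  Psi a w x y tr (closure alpha) =
  (1 / (a * w)) ^+ n * tr n.+1 (psi u w x y alpha).
Proof.
move=> u0 a0 w0 ww trP; rewrite psi_rho.
rewrite -(Upsilon_closure x y 0 u0 a0 w0 ww trP) /Psi /Upsilon.
by case: (repr _) => m beta; rewrite psi_rho.
Qed.

End PsiInvariance.

Definition ratfun (R : realType) := {fraction {mpoly R[i][6]}}.

(* The six independent variables stand, in order, for u, v, a, b, x, y. *)
Definition ratvar (R : realType) (k : nat) : ratfun R := tofrac 'X_(inord k).

(* Main.v *)
Require Import Defs.
From HB Require Import structures.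
From mathcomp Require Import all_boot all_order all_algebra fraction.
From mathcomp Require Import boolp reals complex.
From mathcomp Require Import mpoly.
From mathcomp Require Import ring.
Import GRing.Theory.
Local Open Scope ring_scope.

(** A link without double points is a singular link, and two such links
    suffice.  They are closures of the braids on four strands
      sigma_1^3 sigma_2^i sigma_1 sigma_3 sigma_2^j sigma_3 sigma_2^k
    with exponents (i, j, k) equal to (-2, 2, -1) for the first link and to
    (2, -1, -2) for the second one, that is, with the same three exponents
    rotated cyclically.  Both braids have exponent sum 5, so that the
    representations rho and psi contribute the same power of w to both values
    of an invariant, and only the traces of the two words in the R_i matter.

    The traces are computed inside the subalgebras spanned by 1, E_i, R_i
    and E_i R_i, which are closed under multiplication ([twistM]).  The last
    strand of these words occurs only in a factor R_3 Y R_3, where Y is an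
    element of the subalgebra of index 2, and the trace allows this factor to
    be replaced by another element of that subalgebra ([markov_sandwich]).
    Conjugation by the half twist on three strands turns the first strand into
    the last one ([trace_flip]), so the word, which has such a factor at either
    end, is reduced to a product in the algebra on two strands
    ([trace_two_sandwiches]).  The outcome is that the two traces differ by
      (v - u)(v + u - 2)(v - 1)^3(b - 1)(u b^2 + (v - 1) a b - a^2) / u^3
    ([trace_difference]).  This is a nonzero rational function, so Upsilon
    distinguishes the links, but it vanishes for v = u, so Psi does not.

    The factor (v - u)(v + u - 2) has a meaning.  The quadratic relation gives
    R_i^2 = 1 where E_i = 0, and there R_i has the eigenvalues 1 and -1; where
    E_i = 1, its eigenvalues are the roots of t^2 - (v - 1) t - u.  Up to sign,
    the factor is the product of the values of this polynomial at 1 and at -1,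
    so it vanishes when the two cases share an eigenvalue.  For v = u they
    share the eigenvalue -1, and R_i satisfies a cubic equation instead of a
    quartic one. *)

(** * Relations between neighbouring generators *)

Lemma adjacent_sym i j : adjacent i j = adjacent j i.
Proof. exact: orbC. Qed.

Section Relations.
Set Implicit Arguments.
Unset Strict Implicit.
Variables (F : fieldType) (u v : F) (n : nat).
Implicit Types i j : 'I_n.-1.
Local Notation R := (btR u v).
Local Notation E := (btE u v).

Lemma btERR i j : adjacent i j -> E i * R j * R i = R j * R i * E j.
Proof. by move=> h; have := bt_relationP (bt_ERR u v h); rewrite !bt_piE. Qed.

Lemma btEER i j : adjacent i j -> E i * E j * R i = R i * E i * E j.
Proof.
move=> h; have := bt_relationP (bt_EER_ERE u v h); rewrite !bt_piE => ->.
by have := bt_relationP (bt_ERE_REE u v h); rewrite !bt_piE.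
Qed.

Lemma btERE i j : adjacent i j -> E j * R i * E j = R i * E i * E j.
Proof.
by move=> h; have := bt_relationP (bt_ERE_REE u v h); rewrite !bt_piE.
Qed.

Lemma btER_sqr i : E i * (R i * R i) = u *: E i + (v - 1) *: (E i * R i).
Proof.
rewrite btR_sqr !mulrDr mulr1 -!scalerAr mulrA btE_idem.
by rewrite -{1}[E i]scale1r -scalerDl [1 + _]addrC subrK.
Qed.

Lemma btE_R_sqr i j : adjacent i j -> E i * (R j * R j) = R j * R j * E i.
Proof.
move=> h; rewrite btR_sqr !mulrDl !mulrDr -!scalerAl -!scalerAr mul1r mulr1.
rewrite (btE_C _ _ i j) [E i * _]mulrA (btE_C _ _ i j) btEER; last first.
  by rewrite adjacent_sym.
by rewrite btER.
Qed.

(** The element R_i^-1 E_j R_i ties the two strands among the three that are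
    not neighbours; the trace treats it as E_j. *)
Lemma bt_sandwichE i j : u != 0 -> adjacent i j ->
  R j * E i * R j = (R i)^-1 * E j * R i
     + (u - 1) *: (E i * E j) + (v - 1) *: (E i * E j * R j).
Proof.
move=> u0 h; have h' : adjacent j i by rewrite adjacent_sym.
apply: (mulrI (btR_unit v i u0)).
have -> : R i * (R j * E i * R j) = E j * R i * (R j * R j).
  by rewrite !mulrA -(btERR h').
rewrite btR_sqr !mulrDr mulr1 -!scalerAr !mulrA divrr ?btR_unit // mul1r.
by rewrite (btERE h).
Qed.

(** The outer factors R_j carry the tie E_i to the strands of E_j, and what
    remains is the braid relation. *)
Lemma bt_sandwichER i j : u != 0 -> adjacent i j ->
  R j * E i * R i * R j = R i * R j * E j * R i.
Proof.
move=> u0 h; have h' : adjacent j i by rewrite adjacent_sym.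
apply: (mulIr (btR_unit v i u0)).
transitivity (R j * (E i * (R i * R j * R i))); first by rewrite !mulrA.
rewrite btR_braid //.
transitivity (R j * (E i * R j * R i * R j)); first by rewrite !mulrA.
rewrite (btERR h).
transitivity (R j * (R j * R i * R j) * E j); first by rewrite -!mulrA btER.
rewrite -btR_braid //.
transitivity (R j * R i * R j * (R i * E j)); first by rewrite !mulrA.
by rewrite -btR_braid // -[RHS]mulrA -[RHS]mulrA btE_R_sqr // !mulrA.
Qed.

(** * The algebra of two neighbouring strands *)

(** Coordinates turn identities between products of these elements into
    polynomial identities in the base field. *)
Definition twist i (p q r s : F) : btalg u v n :=
  p%:A + q *: E i + r *: R i + s *: (E i * R i).

Lemma twistD i p q r s p' q' r' s' :
  twist i p q r s + twist i p' q' r' s' =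
  twist i (p + p') (q + q') (r + r') (s + s').
Proof.
by rewrite /twist !scalerDl; do 3![rewrite [LHS]addrACA; congr (_ + _)].
Qed.

Lemma twistZ i c p q r s :
  c *: twist i p q r s = twist i (c * p) (c * q) (c * r) (c * s).
Proof. by rewrite /twist !scalerDr !scalerA. Qed.

Lemma twist1 i : twist i 1 0 0 0 = 1.
Proof. by rewrite /twist !scale0r !addr0 scale1r. Qed.

Lemma twistE i : twist i 0 1 0 0 = E i.
Proof. by rewrite /twist !scale0r scale1r !addr0 add0r. Qed.

Lemma twistR i : twist i 0 0 1 0 = R i.
Proof. by rewrite /twist !scale0r scale1r !addr0 !add0r. Qed.

Lemma twistER i : twist i 0 0 0 1 = E i * R i.
Proof. by rewrite /twist !scale0r scale1r !add0r. Qed.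

Lemma twist_mulE i p q r s : twist i p q r s * E i = twist i 0 (p + q) 0 (r + s).
Proof.
rewrite {1}/twist !mulrDl -!scalerAl mul1r btE_idem -btER -mulrA -btER mulrA.
rewrite btE_idem -twistER -twistE !twistZ !twistD; congr twist; ring.
Qed.

Lemma twist_mulR i p q r s : twist i p q r s * R i =
  twist i r (r * (u - 1) + s * u) p (q + (r + s) * (v - 1)).
Proof.
rewrite {1}/twist !mulrDl -!scalerAl mul1r -mulrA btER_sqr btR_sqr.
rewrite -twistER -twistE -twistR -(twist1 i) !(twistZ, twistD).
congr twist; ring.
Qed.

Lemma twistM i p q r s p' q' r' s' :
  twist i p q r s * twist i p' q' r' s' =
  twist i (p * p' + r * r')
    (p * q' + q * p' + q * q' + r * r' * (u - 1)
       + (r * s' + s * r' + s * s') * u)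
    (p * r' + r * p')
    (p * s' + s * p' + q * r' + r * q' + q * s' + s * q'
       + (r * r' + r * s' + s * r' + s * s') * (v - 1)).
Proof.
rewrite {2}/twist !mulrDr -!scalerAr mulr1 mulrA !(twist_mulE, twist_mulR).
rewrite !(twistZ, twistD); congr twist; ring.
Qed.

Lemma btRV_twist i : u != 0 ->
  (R i)^-1 = twist i 0 ((1 - v) / u) 1 ((1 - u) / u).
Proof.
move=> u0; rewrite btR_inv // /btRV /twist scale0r add0r scale1r.
by congr (_ + _); apply: addrC.
Qed.

(** The half twist reverses the order of the three strands, so it exchanges
    the two crossings. *)
Lemma half_twist_intertwine i j p q r s : adjacent i j ->
  R i * R j * R i * twist i p q r s = twist j p q r s * (R i * R j * R i).
Proof.
move=> h; have h' : adjacent j i by rewrite adjacent_sym.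
have hR : R i * R j * R i * R i = R j * (R i * R j * R i).
  by rewrite {1}btR_braid // !mulrA.
have hE : R i * R j * R i * E i = E j * (R i * R j * R i).
  by rewrite -mulrA -btER [RHS]mulrA !mulrA btERR.
rewrite /twist; set D := R i * R j * R i in hR hE *.
rewrite !mulrDr !mulrDl -!scalerAl -!scalerAr mul1r mulr1 hR hE.
by rewrite [D * _]mulrA hE -mulrA hR mulrA.
Qed.

End Relations.

(** * Removing strands under the trace *)

Section Markov.
Set Implicit Arguments.
Unset Strict Implicit.
Variables (F : fieldType) (u v a b : F) (tr : forall n, {scalar btalg u v n}).
Hypotheses (u0 : u != 0) (trP : is_bt_trace a b tr).
Local Notation up := bt_add_strand.

Lemma bt_trace_intertwine n (D X Y : btalg u v n) :
  D \is a GRing.unit -> D * X = Y * D -> tr n X = tr n Y.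
Proof.
move=> uD h; rewrite -[X](mulKr uD) h (bt_traceC trP) -mulrA divrr //.
by rewrite mulr1.
Qed.

Lemma bt_add_strand_twist n (i : 'I_n.-1) p q r s :
  up (twist u v i p q r s) = twist u v (add_strand i) p q r s.
Proof.
by rewrite /twist !bt_add_strandD !bt_add_strandZ bt_add_strand1
  bt_add_strandM bt_add_strandR bt_add_strandE.
Qed.

Section LastStrand.
Variable n : nat.
Implicit Types X Y : btalg u v n.+1.
Let R := btR u v (n := n.+2) ord_max.
Let E := btE u v (n := n.+2) ord_max.

Lemma markovR X Y : tr n.+2 (up X * R * up Y) = a * tr n.+1 (X * Y).
Proof.
rewrite (bt_traceC trP) mulrA -bt_add_strandM (bt_traceR trP).
by rewrite (bt_traceC trP).
Qed.

Lemma markovE X Y : tr n.+2 (up X * E * up Y) = b * tr n.+1 (X * Y).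
Proof.
rewrite (bt_traceC trP) mulrA -bt_add_strandM (bt_traceE trP).
by rewrite (bt_traceC trP).
Qed.

Lemma markovER X Y : tr n.+2 (up X * E * R * up Y) = a * tr n.+1 (X * Y).
Proof.
rewrite (bt_traceC trP) !mulrA -bt_add_strandM (bt_traceER trP).
by rewrite (bt_traceC trP).
Qed.

Lemma markov_twist X p q r s :
  tr n.+2 (up X * twist u v (n := n.+2) ord_max p q r s) =
  (p + q * b + (r + s) * a) * tr n.+1 X.
Proof.
rewrite /twist !mulrDr -!scalerAr mulr1 mulrA !linearD !linearZ /=.
rewrite (bt_trace_add_strand trP) (bt_traceE trP) (bt_traceR trP).
rewrite (bt_traceER trP); ring.
Qed.

End LastStrand.

(** Conditional expectation, onto the algebra on one strand fewer, of the
    product x y R: here R is the last crossing, x has coordinates p, q, r, s in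
    the algebra of R, and y has coordinates p', q', r', s' in the algebra of
    the crossing before it. *)
Definition sandwich n (i : 'I_n.-1) (p q r s p' q' r' s' : F) : btalg u v n :=
  let g := (u - 1) * b + (v - 1) * a in
  twist u v i
    ((p + q) * a * p' + r * ((1 + g) * p' + b * q' + (r' + s') * a)
       + s * (b + g) * p')
    ((p + q) * a * q' + r * (g * q' + (r' + s') * a * (u - 1))
       + s * ((b + g) * q' + (r' + s') * a * u))
    (p * a * r')
    (p * a * s' + q * a * (r' + s')
       + (r + s) * (r' + s') * a * (v - 1)).

Section Sandwich.
Variable n : nat.
Let R := btR u v (n := n.+3) ord_max.
Let E := btE u v (n := n.+3) ord_max.
Let S := btR u v (n := n.+2) ord_max.
Let T := btE u v (n := n.+2) ord_max.

(** Each product of a basis element for x and one for y with R on the right is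
    brought to a form with at most one occurrence of R, where the Markov rules
    apply. *)
Lemma markov_sandwich (X : btalg u v n.+2) p q r s p' q' r' s' :
  tr n.+3 (up X * twist u v (n := n.+3) ord_max p q r s *
           up (twist u v (n := n.+2) ord_max p' q' r' s') * R) =
  tr n.+2 (X * sandwich (n := n.+2) ord_max p q r s p' q' r' s').
Proof.
rewrite /sandwich; set g := (u - 1) * b + _.
have adj : adjacent (add_strand (n := n.+2) ord_max) (ord_max : 'I_n.+2).
  by rewrite /adjacent /= eqxx.
have adj' : adjacent (ord_max : 'I_n.+2) (add_strand (n := n.+2) ord_max).
  by rewrite adjacent_sym.
set x := R; set e := E; set y := up S; set f := up T.
have Dy : y = btR u v (add_strand (n := n.+2) ord_max).
  exact: bt_add_strandR.
have Df : f = btE u v (add_strand (n := n.+2) ord_max).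
  exact: bt_add_strandE.
(* The relations carry an arbitrary left factor Z, so that they apply inside
   left-associated products. *)
have ef Z : Z * e * f = Z * f * e by rewrite -!mulrA Df btE_C.
have xe Z : Z * x * e = Z * e * x.
  by rewrite -!mulrA; congr (Z * _); rewrite /x btER.
have eyx Z : Z * e * y * x = Z * y * x * f.
  by rewrite -!mulrA; congr (Z * _); rewrite Dy Df !mulrA btERR.
have eye Z : Z * e * y * e = Z * y * f * e.
  by rewrite -!mulrA; congr (Z * _); rewrite Dy Df !mulrA btERE.
have fex Z : Z * f * e * x = Z * x * f * e.
  rewrite -!mulrA; congr (Z * _); rewrite !mulrA Df btE_C btEER //.
  by rewrite -!mulrA btE_C.
have exx Z : Z * e * x * x = u *: (Z * e) + (v - 1) *: (Z * e * x).
  by rewrite -!mulrA btER_sqr mulrDr -!scalerAr.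
have xyx Z : Z * x * y * x = Z * y * x * y.
  by rewrite -!mulrA; congr (Z * _); rewrite !mulrA Dy btR_braid.
have xfx Z : Z * x * f * x = Z * up S^-1 * e * y
    + (u - 1) *: (Z * f * e) + (v - 1) *: (Z * f * e * x).
  have -> : up S^-1 = y^-1 by rewrite bt_add_strandV // btR_unit.
  have := congr1 ( *%R Z) (bt_sandwichE v u0 adj).
  by rewrite -Df -Dy !mulrDr -!scalerAr !mulrA.
have xfyx Z : Z * x * f * y * x = Z * y * x * e * y.
  by rewrite -!mulrA; congr (Z * _); rewrite !mulrA Df Dy bt_sandwichER.
have exfx Z : Z * e * x * f * x = Z * e * x * x * f.
  by rewrite -xe ef fex -ef !xe.
have ST Z : Z * S * T = Z * T * S by rewrite -!mulrA /S /T btER.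
have TT Z : Z * T * T = Z * T by rewrite -mulrA btE_idem.
have h1 : tr n.+3 (up X * x) = a * tr n.+2 X by exact: (bt_traceR trP).
have h2 : tr n.+3 (up X * f * x) = a * tr n.+2 (X * T).
  by rewrite -bt_add_strandM (bt_traceR trP).
have h3 : tr n.+3 (up X * y * x) = a * tr n.+2 (X * S).
  by rewrite -bt_add_strandM (bt_traceR trP).
have h4 : tr n.+3 (up X * f * y * x) = a * tr n.+2 (X * T * S).
  by rewrite -!bt_add_strandM (bt_traceR trP).
have h5 : tr n.+3 (up X * e * x) = a * tr n.+2 X by exact: (bt_traceER trP).
have h6 : tr n.+3 (up X * e * f * x) = a * tr n.+2 (X * T).
  by rewrite ef -bt_add_strandM (bt_traceER trP).
have h7 : tr n.+3 (up X * e * y * x) = a * tr n.+2 (X * T * S).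
  by rewrite eyx -bt_add_strandM markovR ST.
have h8 : tr n.+3 (up X * e * f * y * x) = a * tr n.+2 (X * T * S).
  by rewrite ef eyx -!bt_add_strandM markovR ST TT.
have h9 : tr n.+3 (up X * x * x) = (1 + g) * tr n.+2 X.
  rewrite -mulrA btR_sqr !mulrDr mulr1 -!scalerAr mulrA !linearD !linearZ /=.
  rewrite (bt_trace_add_strand trP) (bt_traceE trP) (bt_traceER trP) /g; ring.
have h10 : tr n.+3 (up X * x * f * x) = b * tr n.+2 X + g * tr n.+2 (X * T).
  rewrite xfx !linearD !linearZ /= -!bt_add_strandM markovE (bt_traceE trP).
  rewrite (bt_traceER trP) mulrVK ?btR_unit // /g; ring.
have h11 : tr n.+3 (up X * x * y * x) = a * tr n.+2 (X * S * S).
  by rewrite xyx -bt_add_strandM markovR.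
have h12 : tr n.+3 (up X * x * f * y * x) = a * tr n.+2 (X * S * S).
  by rewrite xfyx xe -bt_add_strandM markovER.
have h13 : tr n.+3 (up X * e * x * x) = (b + g) * tr n.+2 X.
  rewrite exx linearD !linearZ /= (bt_traceE trP) (bt_traceER trP) /g; ring.
have h14 : tr n.+3 (up X * e * x * f * x) = (b + g) * tr n.+2 (X * T).
  rewrite exfx exx mulrDl -!scalerAl linearD !linearZ /= markovE markovER.
  rewrite /g; ring.
have h15 : tr n.+3 (up X * e * x * y * x) = a * tr n.+2 (X * T * S * S).
  rewrite xyx eyx -(mulrA _ f y) -!bt_add_strandM markovR.
  by rewrite mulrA ST.
have h16 : tr n.+3 (up X * e * x * f * y * x) = a * tr n.+2 (X * T * S * S).
  by rewrite xfyx xe eye -!bt_add_strandM markovER ST.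
have SS Z : Z * S * S = Z + (u - 1) *: (Z * T) + (v - 1) *: (Z * T * S).
  by rewrite -mulrA btR_sqr !mulrDr mulr1 -!scalerAr !mulrA.
rewrite bt_add_strand_twist /twist -Dy -Df -/S -/T -/x -/e.
rewrite !(mulrDl, mulrDr) -!(scalerAl, scalerAr) !(mulr1, mul1r, mulrA).
rewrite !linearD !linearZ /=.
rewrite !(h1, h2, h3, h4, h5, h6, h7, h8, h9, h10, h11, h12, h13, h14, h15, h16).
rewrite !SS !TT !linearD !linearZ /= /g; ring.
Qed.
End Sandwich.

(** The Markov rules remove only the last strand.  Conjugation by the half
    twist of the strands of i and j lets them act on the first one. *)
Lemma trace_flip n (i j : 'I_n.-1) p q r s p' q' r' s' p'' q'' r'' s'' :
  adjacent i j ->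
  tr n (twist u v i p q r s * twist u v i p' q' r' s' *
        (btR u v j ^+ 3 * twist u v i p'' q'' r'' s'' * btR u v j)) =
  tr n (twist u v j p q r s * twist u v j p' q' r' s' *
        (btR u v i ^+ 3 * twist u v j p'' q'' r'' s'' * btR u v i)).
Proof.
move=> h; have h' : adjacent j i by rewrite adjacent_sym.
set D := btR u v i * btR u v j * btR u v i.
have Di c0 c1 c2 c3 : D * twist u v i c0 c1 c2 c3 = twist u v j c0 c1 c2 c3 * D.
  exact: half_twist_intertwine.
have Dj c0 c1 c2 c3 : D * twist u v j c0 c1 c2 c3 = twist u v i c0 c1 c2 c3 * D.
  by rewrite /D btR_braid // half_twist_intertwine.
have Dmul X X' Y Y' : D * X = X' * D -> D * Y = Y' * D -> D * (X * Y) = X' * Y' * D.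
  by move=> hX hY; rewrite mulrA hX -mulrA hY mulrA.
apply: (@bt_trace_intertwine _ D); first by rewrite /D !unitrMl ?btR_unit.
rewrite -!twistR !exprS expr0 !mulr1.
by do ![exact: Di | exact: Dj | apply: (Dmul _ _ _ _)].
Qed.

Lemma cube_twist n (i : 'I_n.-1) :
  btR u v i ^+ 3 = twist u v i 0 ((v - 1) * u) 1 (u - 1 + (v - 1) ^+ 2).
Proof.
rewrite !exprS expr0 mulr1 -twistR !twistM; congr twist; ring.
Qed.

Local Notation r1 := (btR u v (add_strand (n := 3) (add_strand (n := 2) ord_max))).
Local Notation r3 := (btR u v (n := 4) ord_max).
Local Notation t2 := (twist u v (add_strand (n := 3) ord_max)).
Local Notation o := (ord_max : 'I_2.-1).

(** The fourth strand is removed from R_3 Y R_3, and after a flip the first one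
    is removed from R_1^3 X R_1, where R_1^3 is expanded by [cube_twist]. *)
Lemma trace_two_sandwiches p q r s p' q' r' s' p'' q'' r'' s'' :
  tr 4 (r1 ^+ 3 * t2 p q r s * r1 * r3 * t2 p' q' r' s' * r3 * t2 p'' q'' r'' s'') =
  tr 2 (sandwich o 0 0 1 0 p' q' r' s' * twist u v o p'' q'' r'' s'' *
        sandwich o 0 ((v - 1) * u) 1 (u - 1 + (v - 1) ^+ 2) p q r s).
Proof.
rewrite (bt_traceC trP).
set g1 := add_strand (n := 2) ord_max; set g2 : 'I_3.-1 := ord_max.
have adj : adjacent g2 g1 by [].
transitivity (tr 4 (up (twist u v g2 p'' q'' r'' s'' *
    (btR u v g1 ^+ 3 * twist u v g2 p q r s * btR u v g1)) *
    twist u v (n := 4) ord_max 0 0 1 0 * up (twist u v g2 p' q' r' s') * r3)).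
  rewrite !exprS !expr0 !mulr1 !bt_add_strandM !bt_add_strandR.
  by rewrite !bt_add_strand_twist twistR !mulrA.
rewrite markov_sandwich (bt_traceC trP) mulrA /sandwich trace_flip //.
rewrite cube_twist mulrA -!bt_add_strand_twist mulrA -bt_add_strandM.
by rewrite markov_sandwich.
Qed.

(** Both traces are explicit by [trace_two_sandwiches] and [twistM], and
    their difference splits into small factors.  The one that matters is
    v - u. *)
Lemma trace_difference :
  let x := btR u v (add_strand (n := 3) ord_max) in
  let t (X Y Z : btalg u v 4) :=
    tr 4 (r1 ^+ 3 * X * r1 * r3 * Y * r3 * Z) in
  t (x^-1 * x^-1) (x * x) x^-1 - t (x * x) x^-1 (x^-1 * x^-1) =
  (v - u) * (v + u - 2) * (v - 1) ^+ 3 * (b - 1)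
    * (u * b ^+ 2 + (v - 1) * a * b - a ^+ 2) / u ^+ 3.
Proof.
move=> x t; have xV : x^-1 = t2 0 ((1 - v) / u) 1 ((1 - u) / u).
  exact: btRV_twist.
have xE : x = t2 0 0 1 0 by rewrite twistR.
have xx : x * x = t2 1 (u - 1) 0 (v - 1).
  by rewrite xE twistM; congr twist; ring.
have xVxV : x^-1 * x^-1 =
    t2 1 ((u + (v - 1) ^+ 2) / u ^+ 2 - 1) 0 ((1 - v) / u ^+ 2).
  by rewrite xV twistM; congr twist; field.
rewrite /t xx xVxV xV !trace_two_sandwiches /sandwich !twistM.
have tr2 p q r s : tr 2 (twist u v o p q r s) = p + q * b + (r + s) * a.
  have := markov_twist (n := 0) 1 p q r s.
  by rewrite bt_add_strand1 mul1r (bt_trace1 trP) mulr1.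
rewrite !tr2; field; exact: u0.
Qed.
End Markov.

(** * The two links *)

Section LinkPair.
Set Implicit Arguments.
Unset Strict Implicit.
Local Notation s1 :=
  (sigma (n := 4) (add_strand (n := 3) (add_strand (n := 2) ord_max))).
Local Notation s2 := (sigma (n := 4) (add_strand (n := 3) ord_max)).
Local Notation s2V := (sigmaV (n := 4) (add_strand (n := 3) ord_max)).
Local Notation s3 := (sigma (n := 4) ord_max).

Definition three_twist_closure (x y z : sbraid 4) : singular_link :=
  Defs.closure (s1 * s1 * s1 * x * s1 * s3 * y * s3 * z)%g.

Definition twist_link := three_twist_closure (s2V * s2V)%g (s2 * s2)%g s2V.
Definition rotated_twist_link := three_twist_closure (s2 * s2)%g s2V (s2V * s2V)%g.

(** The exponent sum 5 gives w^5, and the normalization divides by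
    (a w)^3. *)
Lemma Upsilon_difference (F : fieldType) (u v a b w x y z : F)
    (tr : forall n, {scalar btalg u v n}) :
  u != 0 -> a != 0 -> w != 0 -> w ^+ 2 = (a + (1 - v) * b) / (a * u) ->
  is_bt_trace a b tr ->
  Upsilon a w x y z tr twist_link - Upsilon a w x y z tr rotated_twist_link =
  (w ^+ 2 / a ^+ 3) *
  ((v - u) * (v + u - 2) * (v - 1) ^+ 3 * (b - 1)
    * (u * b ^+ 2 + (v - 1) * a * b - a ^+ 2) / u ^+ 3).
Proof.
move=> u0 a0 w0 ww trP; rewrite -(trace_difference u0 trP).
rewrite /twist_link /rotated_twist_link /three_twist_closure.
rewrite !(Upsilon_closure _ _ _ u0 a0 w0 ww trP).
rewrite !rhoM // !rho_sigma // !rho_sigmaV //.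
rewrite -!(scalerAl, scalerAr) !scalerA !linearZ /= !exprS !expr0 !mulr1.
rewrite !mulrA; field.
by rewrite a0 w0.
Qed.

End LinkPair.

(** * Nonvanishing in extensions of the field of rational functions *)

Lemma ratfun_neq0 (R : realType) (L : fieldType)
    (iota : {rmorphism ratfun R -> L}) (p : {mpoly R[i][6]}) (e : 'I_6 -> R[i]) :
  p.@[e] != 0 -> iota (tofrac p) != 0.
Proof.
apply: contra; rewrite fmorph_eq0 tofrac_eq0 => /eqP ->.
by rewrite meval0.
Qed.

(** One point of evaluation takes care of all nonvanishing conditions: at
    u = 1, v = 2, a = 1 and b = 0 each polynomial below is 1 or -1. *)
Lemma coefficients_neq0 (P : comNzRingType) (L K : fieldType)
    (phi : {rmorphism P -> L}) (ev : {rmorphism P -> K}) (U V A B : P) :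
  (forall p, ev p != 0 -> phi p != 0) ->
  ev U = 1 -> ev V = 2 -> ev A = 1 -> ev B = 0 ->
  let u := phi U in let v := phi V in let a := phi A in let b := phi B in
  [/\ u != 0, a != 0, a + (1 - v) * b != 0, a + (1 - u) * b != 0
    & (v - u) * (v + u - 2) * (v - 1) ^+ 3 * (b - 1)
      * (u * b ^+ 2 + (v - 1) * a * b - a ^+ 2) != 0].
Proof.
move=> phi_neq0 eU eV eA eB u v a b.
have nz p : ev p ^+ 2 = 1 -> phi p != 0.
  move=> pe; apply: phi_neq0; apply/eqP=> p0; move/eqP: pe.
  by rewrite p0 expr0n /= eq_sym oner_eq0.
have iE := (rmorphD, rmorphN, rmorphM, rmorphXn, rmorph1, rmorph_nat).
split; first by apply: nz; rewrite eU; ring.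
- by apply: nz; rewrite eA; ring.
- have := nz (A + (1 - V) * B); rewrite !iE; apply.
  by rewrite eV eA eB; ring.
- have := nz (A + (1 - U) * B); rewrite !iE; apply.
  by rewrite eU eA eB; ring.
have := nz ((V - U) * (V + U - 2) * (V - 1) ^+ 3 * (B - 1)
  * (U * B ^+ 2 + (V - 1) * A * B - A ^+ 2)).
by rewrite !iE; apply; rewrite eU eV eA eB; ring.
Qed.

Theorem proposition5 (R : realType) :
  exists SL1 SL2 : singular_link,
  forall (L : fieldType) (iota : {rmorphism ratfun R -> L}),
  let u := iota (ratvar R 0) in
  let v := iota (ratvar R 1) in
  let a := iota (ratvar R 2) in
  let b := iota (ratvar R 3) in
  let x := iota (ratvar R 4) in
  let y := iota (ratvar R 5) in
  forall (w sqrtc : L)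
    (trU : forall n : nat, {scalar btalg u v n})
    (trP : forall n : nat, {scalar btalg u u n}),
  w ^+ 2 = (a + (1 - v) * b) / (a * u) ->
  sqrtc ^+ 2 = (a + (1 - u) * b) / (a * u) ->
  is_bt_trace a b trU ->
  is_bt_trace a b trP ->
  Upsilon a w x y 0 trU SL1 <> Upsilon a w x y 0 trU SL2 /\
  Psi a sqrtc x y trP SL1 = Psi a sqrtc x y trP SL2.
Proof.
exists twist_link, rotated_twist_link => L iota u v a b x y w c trU trP ww cc trUP trPP.
pose e (k : 'I_6) : R[i] := nth 0 [:: 1; 2; 1] k.
have eX k : (k < 6)%N ->
    ('X_(inord k) : {mpoly R[i][6]}).@[e] = nth 0 [:: 1; 2; 1] k.
  by move=> lt_k6; rewrite mevalXU /e inordK.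
pose phi : {rmorphism {mpoly R[i][6]} -> L} := iota \o @tofrac {mpoly R[i][6]}.
have [u0 a0 sumU sumP diff] := @coefficients_neq0 _ _ _ phi (meval e) _ _ _ _
  (fun p => @ratfun_neq0 R L iota p e)
  (eX 0%N isT) (eX 1%N isT) (eX 2%N isT) (eX 3%N isT).
have sqrt_neq0 s t : t != 0 -> s ^+ 2 = t / (a * u) -> s != 0.
  move=> t0 ss; have : s ^+ 2 != 0.
    by rewrite ss mulf_neq0 // invr_eq0 mulf_neq0.
  by rewrite expf_eq0.
have w0 := sqrt_neq0 _ _ sumU ww; have c0 := sqrt_neq0 _ _ sumP cc.
split.
  apply/eqP; rewrite -subr_eq0 (Upsilon_difference _ _ _ u0 a0 w0 ww trUP).
  by apply: mulf_neq0; apply: mulf_neq0; rewrite ?invr_eq0 ?expf_neq0.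
(* Psi is Upsilon for v = u and z = 0. *)
have PsiE SL : Psi a c x y trP SL = Upsilon a c x y 0 trP SL.
  by rewrite /Psi /Upsilon; case: (repr SL) => n alpha; rewrite psi_rho.
apply/eqP; rewrite !PsiE -subr_eq0.
by rewrite (Upsilon_difference _ _ _ u0 a0 c0 cc trPP) subrr !mul0r mulr0.
Qed.
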